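(* Let $N\ge 1$ be an integer, $0<p<1$, $0<b\le 1-p$, and let the offspring distribution of a Bienaymé–Galton–Watson process have the fractional linear probability generating function $$f(s)=1-\frac{b}{1-p}+\frac{bs}{1-ps}.$$ Let $V_N$ be the number of disjoint complete infinite $N$-ary subtrees rooted at the ancestor of the family tree. Let $\tau_N$ be the largest solution $\tau$ in $[0,1]$ of $$1-p(1-\tau)=\left[\frac{b}{1-p}\right]^{1/N}[p\tau]^{1-1/N}$$ (with $\tau_N=0$ if this equation has no solution in $[0,1]$), and let $$\theta_N=\left(\frac{p\tau_N}{1-p(1-\tau_N)}\right)^N.$$ Then $V_N$ follows a zero-modified geometric (i.e. fractional linear) distribution: $$P(V_N=j)=\frac{b}{p(1-p)}(1-\theta_N)\theta_N^{\,j}\quad (j\ge 1),\qquad P(V_N=0)=1-\frac{b}{p(1-p)}\theta_N,$$ and $$E V_N=\frac{b}{p(1-p)}\,\frac{\theta_N}{1-\theta_N}.$$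
   Context: The process starts with one ancestor (the root); each individual independently has $k$ children with probability $p_k$, where $f(s)=\sum_k p_k s^k$ (here $p_k=bp^{k-1}$ for $k\ge1$ and $p_0=1-\sum_{k\ge 1}p_k$). The family tree has the individuals as nodes and the parent–child relations as arcs. A complete infinite $N$-ary tree is a rooted tree in which every node has exactly $N$ children. Subtrees considered are those rooted at the ancestor; two such subtrees are disjoint if they have no common node other than the root. $V_N$ is the (maximal) number of pairwise disjoint complete infinite $N$-ary subtrees of the family tree rooted at the ancestor. In the equation for $\tau_N$, $0^0=1$ (relevant for $N=1$). *)

(* Defs.v *)
From mathcomp Require Import all_boot all_order all_algebra.
From mathcomp Require Import all_classical all_reals all_analysis.

Set Implicit Arguments.
Unset Strict Implicit.
Unset Printing Implicit Defensive.

Import Order.TTheory GRing.Theory Num.Theory.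

Local Open Scope classical_set_scope.
Local Open Scope card_scope.
Local Open Scope ring_scope.

(* Individuals carry Ulam-Harris labels: [::] is the ancestor and the children
   of u are rcons u 0, rcons u 1, ... *)
Definition node := seq nat.

(* [c u] is the number of children of the potential individual u. *)
Inductive family_tree (c : node -> nat) : set node :=
| family_root : family_tree c [::]
| family_child (u : node) (i : nat) :
    family_tree c u -> (i < c u)%N -> family_tree c (rcons u i).

(* A subtree rooted at the ancestor is given by its set of nodes; its arcs are
   the parent-child arcs of the family tree between these nodes. For N > 0 such
   a subtree is necessarily infinite. *)
Definition complete_nary_subtree (N : nat) (T S : set node) : Prop :=
  [/\ S `<=` T,
      S [::],
      (forall u i, S (rcons u i) -> S u) &
      (forall u, S u -> [set i | S (rcons u i)] #= `I_N)].

Definition disjoint_nary_subtrees (N : nat) (T : set node) (n : nat) : Prop :=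
  exists F : 'I_n -> set node,
    (forall i, complete_nary_subtree N T (F i)) /\
    (forall i j, i != j -> F i `&` F j = [set [::]]).

(* The maximal number of pairwise disjoint subtrees, as a supremum in \bar R, so
   that no boundedness is presupposed; n = 0 always belongs to the set. *)
Definition max_disjoint_nary_subtrees (R : realType) (N : nat) (T : set node)
    : \bar R :=
  ereal_sup [set n%:R%:E | n in disjoint_nary_subtrees N T].

Section Process.
Context (d : measure_display) (Om : measurableType d) (R : realType)
        (P : probability Om R).

Definition mutually_independent (I : eqType) (xi : I -> {RV P >-> nat})
    : Prop :=
  forall (s : seq I) (B : I -> set nat), uniq s ->
    (P (\bigcap_(i in [set` s]) (xi i @^-1` B i)) =
     \prod_(i <- s) P (xi i @^-1` B i))%E.

(* Offspring numbers are attached to all labels, including those of individuals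
   that are never born. *)
Definition BGW_process (q : nat -> R) (xi : node -> {RV P >-> nat}) : Prop :=
  mutually_independent xi /\
  (forall u k, P (xi u @^-1` [set k]) = (q k)%:E).

Definition V (N : nat) (xi : node -> {RV P >-> nat}) (w : Om) : \bar R :=
  max_disjoint_nary_subtrees R N (family_tree (fun u => xi u w)).

End Process.

Section FractionalLinear.
Context (R : realType).

Definition pgf (q : nat -> R) (s : R) : \bar R :=
  (\sum_(0 <= k <oo) (q k * s ^+ k)%:E)%E.

Definition fractional_linear (b p s : R) : R :=
  1 - b / (1 - p) + b * s / (1 - p * s).

(* powR satisfies 0 `^ 0 = 1, as needed for N = 1 and t = 0. *)
Definition tau_solutions (b p : R) (N : nat) : set R :=
  [set t | 0 <= t <= 1 /\
     1 - p * (1 - t) =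
     (b / (1 - p)) `^ (N%:R^-1) * (p * t) `^ (1 - N%:R^-1)].

(* The largest solution, 0 if there is none: the solution set is compact, so the
   default value is taken only when it is empty. *)
Definition tau (b p : R) (N : nat) : R :=
  xget 0 (tau_solutions b p N `&` ubound (tau_solutions b p N)).

Definition theta (b p : R) (N : nat) : R :=
  (p * tau b p N / (1 - p * (1 - tau b p N))) ^+ N.

End FractionalLinear.

(* Main.v *)
(* An individual is the root of a complete N-ary subtree iff at least N of its
   children are, so V_N is the number Z of such children of the ancestor divided
   by N, rounded down. Subtrees hanging from distinct children depend on disjoint
   families of offspring numbers, so Z counts the offspring thinned with
   probability x = P(V_N >= 1). Thinning keeps the law of the offspring number in
   the zero-modified geometric family, P(Z >= m) = b / (p (1 - p)) r(x)^m for
   m >= 1 with r(x) = p x / (1 - p (1 - x)); hence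
   P(V_N >= j) = b / (p (1 - p)) (r(x)^N)^j for j >= 1. For j = 1 this is a fixed
   point equation for x, equivalent to the one defining tau_N when x > 0. By
   Koenig's lemma x is the limit of the probabilities of having an N-ary subtree
   of depth n, which are the iterates at 1 of the monotone map of the fixed point
   equation, so x is its largest fixed point in [0, 1]. *)
Require Import Defs.
From mathcomp Require Import all_boot all_order all_algebra.
From mathcomp Require Import all_classical all_reals all_analysis.
From mathcomp Require Import measurable_realfun.
From mathcomp Require Import ring.
Import Order.TTheory GRing.Theory Num.Theory.

Local Open Scope classical_set_scope.
Local Open Scope ring_scope.

Set Implicit Arguments.
Unset Strict Implicit.

(** * Complete N-ary subtrees of a fixed tree *)

Section NaryTrees.
Context (N : nat) (c : node -> nat).
Local Open Scope nat_scope.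

(** Defined at every label, born or not, so that its value at [u] depends only on the offspring
    numbers of [u] and of the labels below it. *)
Fixpoint nary_to_depth (n : nat) (u : node) : bool :=
  if n is m.+1 then
    N <= count (fun i => nary_to_depth m (rcons u i)) (iota 0 (c u))
  else true.

(** Asking for every finite depth instead of one infinite tree makes the event a countable
    intersection; Koenig's lemma recovers the infinite tree. *)
Definition nary_rooted (u : node) : bool := `[< forall n, nary_to_depth n u >].

Lemma nary_to_depthS n u : nary_to_depth n.+1 u -> nary_to_depth n u.
Proof.
elim: n u => [//|n IH] u /= Nle; apply: (leq_trans Nle).
by apply: sub_count => i; exact: IH.
Qed.

Lemma nary_to_depth_le m n u : m <= n -> nary_to_depth n u -> nary_to_depth m u.
Proof.
move=> /subnK <-; elim: (n - m) => [//|k IH]; rewrite addSn => /nary_to_depthS.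
exact: IH.
Qed.

(* Koenig's lemma: as u has finitely many children, some depth already excludes
   all children that are not roots of infinite trees. *)
Lemma nary_to_depth_stable (u : node) (s : seq nat) :
  exists n, {in s, forall i, nary_to_depth n (rcons u i) = nary_rooted (rcons u i)}.
Proof.
elim: s => [|i s [n Hn]]; first by exists 0.
have [/asboolP gi|/asboolP/existsNP[m /negP gi]] := boolP (nary_rooted (rcons u i)).
  exists n => j; rewrite inE => /orP[/eqP ->|/Hn//].
  by rewrite gi; apply/esym/asboolP.
(* Depth [m] excludes child [i] and depth [n] settles the others; deeper conditions are stronger, so
   the maximum does both. *)
exists (maxn m n) => j; rewrite inE => /orP[/eqP ->|js].
  rewrite (negbTE (contra (nary_to_depth_le (leq_maxl m n)) gi)).
  by apply/esym/negbTE/asboolP => /(_ m); exact/negP.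
rewrite -Hn //; apply/idP/idP; first exact: nary_to_depth_le (leq_maxr m n).
rewrite Hn // => /asboolP; exact.
Qed.

(** At a depth where all children of [u] are settled, the condition one level deeper at [u] counts
    exactly its rooted children. *)
Lemma nary_rootedE u :
  nary_rooted u = (N <= count (fun i => nary_rooted (rcons u i)) (iota 0 (c u))).
Proof.
apply/asboolP/idP => [gu|le [//|n] /=].
  have [n Hn] := nary_to_depth_stable u (iota 0 (c u)).
  by rewrite -(eq_in_count Hn); exact: (gu n.+1).
by apply: (leq_trans le); apply: sub_count => i /asboolP.
Qed.

Lemma family_tree_rcons u i : family_tree c (rcons u i) -> i < c u.
Proof.
move=> H; inversion H as [E|v j _ jv E]; first by case: (u) E.
by move: E => /rcons_inj[<- <-].
Qed.

Lemma card_eq_IIP (A : set nat) :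
  (A #= `I_N)%card <-> exists s, [/\ uniq s, size s = N & A = [set` s]].
Proof.
split=> [AN|[s []]].
  exists (finmap.enum_fset (fset_set A)); split; first exact: finmap.fset_uniq.
    exact: card_fset_set.
  by rewrite fset_setK //; apply/finite_setP; exists N.
elim: s N A => [|x s IH] [|n] A //=.
  by move=> _ _ ->; rewrite set_nil -II0.
move=> /andP[xs us] [ss] ->; apply/eq_cardSP; exists x.
  by rewrite /= mem_head.
apply: IH => //; apply/seteqP; split=> y /=.
  by rewrite inE => -[/orP[/eqP ->|//] /(_ erefl)].
by move=> ys; split; [rewrite inE ys orbT|move=> E; rewrite -E ys in xs].
Qed.

(** Induction on the depth: the [N] children kept by [S] are distinct labels below [c u] and satisfy
    the condition for the previous depth. *)
Lemma subtree_nary_rooted (S : set node) u :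
  complete_nary_subtree N (family_tree c) S -> S u -> nary_rooted u.
Proof.
move=> [Sc _ _ Sch] Su; apply/asboolP => n.
elim: n u Su => [//|n IH] u Su /=.
have /card_eq_IIP[s [us <- Es]] := Sch u Su.
rewrite -size_filter; apply: uniq_leq_size => // i si.
have Si : S (rcons u i) by have : [set` s] i by []; rewrite -Es.
by rewrite mem_filter IH //= mem_iota family_tree_rcons //; exact: Sc.
Qed.

Inductive chosen_tree (ch : node -> seq nat) : set node :=
| chosen_root : chosen_tree ch [::]
| chosen_child u i : chosen_tree ch u -> i \in ch u -> chosen_tree ch (rcons u i).

Lemma chosen_tree_rcons ch u i :
  chosen_tree ch (rcons u i) -> chosen_tree ch u /\ i \in ch u.
Proof.
move=> H; inversion H as [E|v j Hv jv E]; first by case: (u) E.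
by move: E => /rcons_inj[<- <-].
Qed.

Lemma chosen_tree_head ch u :
  chosen_tree ch u -> u = [::] \/ head 0 u \in ch [::].
Proof.
elim=> [|v i Hv IH iv]; [by left|right].
by case: v Hv IH iv => [//|j v] Hv [//|].
Qed.

Lemma chosen_tree_complete ch :
  (forall u, chosen_tree ch u ->
    [/\ uniq (ch u), size (ch u) = N & {subset ch u <= iota 0 (c u)}]) ->
  complete_nary_subtree N (family_tree c) (chosen_tree ch).
Proof.
move=> Hch; split.
- move=> u; elim=> [|v i Hv IH iv]; first exact: family_root.
  apply: family_child => //; have [_ _ /(_ _ iv)] := Hch _ Hv.
  by rewrite mem_iota.
- exact: chosen_root.
- by move=> u i /chosen_tree_rcons[].
- move=> u Hu; apply/card_eq_IIP; exists (ch u).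
  have [? ? _] := Hch _ Hu; split => //.
  by apply/seteqP; split=> i /=; [move/chosen_tree_rcons => -[]|exact: chosen_child].
Qed.

Definition nary_children (u : node) : seq nat :=
  [seq i <- iota 0 (c u) | nary_rooted (rcons u i)].

(** The selections for different [k] differ only at the ancestor, where each takes its own block of
    [N] consecutive rooted children. *)
Definition block_choice (k : nat) (u : node) : seq nat :=
  if u is [::] then take N (drop (k * N) (nary_children [::]))
  else take N (nary_children u).

Lemma mem_nary_children u i : i \in nary_children u -> nary_rooted (rcons u i).
Proof. by rewrite mem_filter => /andP[]. Qed.

(** Each reached node other than the ancestor was selected as rooted, so [nary_rootedE] grants it
    [N] rooted children; at the ancestor the size bound makes block [k] full. *)
Lemma block_choice_complete k : k.+1 * N <= size (nary_children [::]) ->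
  complete_nary_subtree N (family_tree c) (chosen_tree (block_choice k)).
Proof.
move=> kN; have uc u : uniq (nary_children u) by rewrite filter_uniq ?iota_uniq.
have sub u : {subset nary_children u <= iota 0 (c u)}.
  by move=> i; rewrite mem_filter => /andP[].
apply: chosen_tree_complete => u Hu.
have : u = [::] \/ nary_rooted u.
  elim: Hu => [|v i _ _ iv]; [by left|right].
  apply: mem_nary_children; case: v iv => [|j v]; last exact: mem_take.
  by move/mem_take/mem_drop.
case: u Hu => [|j u] _; [move=> _|case=> [//|gu]]; split=> /=.
- by rewrite take_uniq ?drop_uniq.
- by apply: size_takel; rewrite size_drop leq_subRL; rewrite mulSn addnC in kN => //;
    apply: leq_trans kN; rewrite leq_addr.
- by move=> i /mem_take/mem_drop /sub.
- by rewrite take_uniq.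
- by apply: size_takel; rewrite size_filter -nary_rootedE.
- by move=> i /mem_take /sub.
Qed.

(** A common node other than the ancestor would have its first label in both blocks, but these
    occupy separate positions of a duplicate-free list. *)
Lemma block_choice_disjoint k l u : k < l ->
  chosen_tree (block_choice k) u -> chosen_tree (block_choice l) u -> u = [::].
Proof.
move=> kl /chosen_tree_head[//|hk] /chosen_tree_head[//|] /=.
move: hk => /=; set s := nary_children _; set h := head 0 u => hk hl.
have us : uniq s by rewrite filter_uniq ?iota_uniq.
have {}hl : h \in drop (l * N) s by exact: mem_take hl.
(* Block [k] ends at position [(k + 1) * N], which is at most [l * N], where block [l] starts. *)
have {}hk : h \in take (l * N) s.
  have hk' : h \in take (N + k * N) s by move: hk; rewrite take_drop => /mem_drop.
  rewrite -(cat_take_drop (N + k * N) (take (l * N) s)) mem_cat.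
  by rewrite take_takel ?hk' // -mulSn leq_mul2r kl orbT.
move: us; rewrite -(cat_take_drop (l * N) s) cat_uniq => /and3P[_ /hasPn/(_ h hl)].
by rewrite /= hk.
Qed.

(** Forwards, each subtree uses [N] rooted children of the ancestor, and disjointness makes all
    [n * N] labels distinct. Backwards, the blocks yield [n] subtrees. *)
Lemma disjoint_nary_subtreesP n :
  disjoint_nary_subtrees N (family_tree c) n <->
  n * N <= count (fun i => nary_rooted [:: i]) (iota 0 (c [::])).
Proof.
rewrite -size_filter -/(nary_children [::]); split=> [[F [FN Fd]]|le].
  have ex (i : 'I_n) : exists s,
      [/\ uniq s, size s = N & [set j | F i [:: j]] = [set` s]].
    by apply/card_eq_IIP; have [_ F0 _ /(_ _ F0)] := FN i.
  have /choice[s Hs] := ex.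
  have sF i j : (j \in s i) = `[< F i [:: j] >].
    have [_ _ E] := Hs i; apply/idP/asboolP => [js|Fij].
      by have : [set` s i] j by []; rewrite -E.
    by have : [set j | F i [:: j]] j by []; rewrite E.
  have -> : n * N = size (flatten [seq s i | i <- enum 'I_n]).
    rewrite size_flatten sumnE /shape 2!big_map (eq_bigr (fun=> N)) => [|i _].
      by rewrite big_const_seq count_predT iter_addn_0 mulnC size_enum_ord.
    by have [] := Hs i.
  apply: uniq_leq_size.
    have : uniq (enum 'I_n) by exact: enum_uniq.
    elim: (enum _) => [//|i e IH] /= /andP[ie /IH ue].
    rewrite cat_uniq ue andbT; have [-> _ _] /= := Hs i.
    apply/hasPn => j /flattenP[_ /mapP[k ke ->]]; rewrite !sF => /asboolP Fk.
    apply/asboolP => Fi.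
    have ik : i != k by apply: contra ie => /eqP ->.
    by have : (F i `&` F k) [:: j] by []; rewrite Fd.
  move=> j /flattenP[_ /mapP[k _ ->]]; rewrite sF => /asboolP Fk.
  rewrite mem_filter mem_iota /= add0n (subtree_nary_rooted (S := F k)) //=.
  by apply: (@family_tree_rcons [::]); have [+ _ _ _] := FN k; apply.
exists (fun i => chosen_tree (block_choice i)); split=> [i|i j ij].
  by apply: block_choice_complete; apply: leq_trans le; rewrite leq_mul2r ltn_ord orbT.
apply/seteqP; split=> [u [ui uj]|u ->]; last by split; exact: chosen_root.
have /orP[lt|lt] : (i < j) || (j < i) by rewrite -neq_ltn.
  exact: block_choice_disjoint lt ui uj.
exact: block_choice_disjoint lt uj ui.
Qed.

Lemma max_disjoint_nary_subtreesE (R : realType) : 0 < N ->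
  max_disjoint_nary_subtrees R N (family_tree c) =
  (count (fun i => nary_rooted [:: i]) (iota 0 (c [::])) %/ N)%:R%:E.
Proof.
move=> N0; apply/eqP; rewrite eq_le; apply/andP; split.
  apply: ge_ereal_sup => _ [n /disjoint_nary_subtreesP nN <-].
  by rewrite lee_fin ler_nat leq_divRL.
apply: ereal_sup_ubound; eexists; last reflexivity.
by apply/disjoint_nary_subtreesP; exact: leq_divM.
Qed.

End NaryTrees.

(** * Events generated by disjoint families of independent variables *)

Section Independence.
Context (d : measure_display) (Om : measurableType d) (R : realType)
        (P : probability Om R) (I : choiceType) (xi : I -> {RV P >-> nat}).

(** A pi-system generating the sigma-algebra of the [xi u] with [u] in [W]; on it mutual
    independence gives product formulas directly. *)
Definition cylinders (W : set I) : set (set Om) :=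
  [set A | exists s B, [/\ uniq s, [set` s] `<=` W &
     A = \bigcap_(u in [set` s]) (xi u @^-1` B u)]].

Definition events_of (W : set I) : set (set Om) := <<s cylinders W >>.

Lemma measurable_RV_preimage u (B : set nat) : measurable (xi u @^-1` B).
Proof. by rewrite -[_ @^-1` _]setTI; exact: measurable_funP. Qed.

Lemma cylinders_setI_closed W : setI_closed (cylinders W).
Proof.
move=> _ _ [s [B [us sW ->]]] [t [C [ut tW ->]]].
(* A label may occur in both lists; the guards impose [B u] and [C u] only where the respective list
   mentions [u]. *)
exists (undup (s ++ t)), (fun u => [set k | (u \in s -> B u k) /\ (u \in t -> C u k)]).
split; first exact: undup_uniq.
  by move=> u /=; rewrite mem_undup mem_cat => /orP[/sW|/tW].
apply/seteqP; split=> w /=.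
  by move=> [Bw Cw] u _; split=> [/Bw|/Cw].
by move=> h; split=> u /= ut'; have /h[] : u \in undup (s ++ t);
  rewrite ?mem_undup ?mem_cat ?ut' ?orbT //; auto.
Qed.

Lemma events_of_measurable W A : events_of W A -> measurable A.
Proof.
apply: smallest_sub; first exact: sigma_algebra_measurable.
move=> _ [s [B [_ _ ->]]]; rewrite bigcap_seq.
by apply: bigsetI_measurable => u _; exact: measurable_RV_preimage.
Qed.

Lemma events_of_sub W W' A : W `<=` W' -> events_of W A -> events_of W' A.
Proof.
move=> WW'; move: A; apply: smallest_sub; first exact: smallest_sigma_algebra.
move=> _ [s [B [us sW ->]]]; apply: sub_gen_smallest.
by exists s, B; split=> //; exact: subset_trans WW'.
Qed.

Lemma events_of_preimage (W : set I) u (B : set nat) : W u -> events_of W (xi u @^-1` B).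
Proof.
move=> Wu; apply: sub_gen_smallest; exists [:: u], (fun=> B); split => //.
  by move=> v /=; rewrite inE => /eqP ->.
by rewrite set_cons1 bigcap_set1.
Qed.

Lemma events_ofC W A : events_of W A -> events_of W (~` A).
Proof. by have [_ + _] := smallest_sigma_algebra setT (cylinders W); rewrite -setTD; apply. Qed.

Lemma events_of_bigcup W (F : nat -> set Om) :
  (forall n, events_of W (F n)) -> events_of W (\bigcup_n F n).
Proof. by have [_ _] := smallest_sigma_algebra setT (cylinders W); apply. Qed.

Lemma events_of0 W : events_of W set0.
Proof. by have [] := smallest_sigma_algebra setT (cylinders W). Qed.

Lemma events_ofU W A B : events_of W A -> events_of W B -> events_of W (A `|` B).
Proof.
move=> WA WB; rewrite -bigcup2E; apply: events_of_bigcup => -[|[|n]] //=.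
exact: events_of0.
Qed.

Lemma events_ofI W A B : events_of W A -> events_of W B -> events_of W (A `&` B).
Proof.
move=> WA WB; rewrite -[A `&` B]setCK setCI.
by apply: events_ofC; apply: events_ofU; exact: events_ofC.
Qed.

Lemma events_of_bigcap W (F : nat -> set Om) :
  (forall n, events_of W (F n)) -> events_of W (\bigcap_n F n).
Proof.
move=> WF; rewrite -[X in events_of W X]setCK setC_bigcap.
by apply: events_ofC; apply: events_of_bigcup => n; exact: events_ofC.
Qed.

Lemma dynkin_independent (B : set Om) : measurable B ->
  dynkin [set A | measurable A /\ P (A `&` B) = (P A * P B)%E].
Proof.
move=> mB; split.
- by split; rewrite ?setTI ?probability_setT ?mul1e.
- move=> A [mA AB]; split; first exact: measurableC.
  rewrite probability_setC // muleBl ?mul1e ?fin_num_measure // -AB.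
  rewrite setIC -setDE measureD ?[B `&` A]setIC //.
  by rewrite ltey_eq fin_num_measure.
- move=> F tF HF; have mF n : measurable (F n) by have [] := HF n.
  split; first exact: bigcup_measurable.
  rewrite setI_bigcupl !measure_semi_bigcup //.
  + rewrite muleC -[P B]fineK ?fin_num_measure // -nneseriesZl //.
    by apply: eq_eseriesr => n _; rewrite fineK ?fin_num_measure // muleC; have [] := HF n.
  + exact: bigcup_measurable.
  + by move=> n; exact: measurableI.
  + by under eq_fun do rewrite setIC; exact: trivIset_setIl.
  + by apply: bigcup_measurable => n _; exact: measurableI.
Qed.

(** The pi-lambda theorem, in each argument in turn, reduces the claim to two cylinders, where
    mutual independence for the concatenated label lists factors the probability. *)
Lemma events_of_independent (W W' : set I) (A B : set Om) :
  mutually_independent xi -> W `&` W' = set0 ->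
  events_of W A -> events_of W' B -> P (A `&` B) = (P A * P B)%E.
Proof.
move=> ind WW' WA W'B.
(* Extends one argument from cylinders to all events; [C] is first [B], then a cylinder over [W]. *)
have sigma_ind V (C : set Om) : measurable C ->
    (forall D, cylinders V D -> P (D `&` C) = (P D * P C)%E) ->
    forall D, events_of V D -> P (D `&` C) = (P D * P C)%E.
  move=> mC VC D VD; have cylm E : cylinders V E -> measurable E.
    by move=> VE; apply: (@events_of_measurable V); exact: sub_gen_smallest.
  suff : [set D | measurable D /\ P (D `&` C) = (P D * P C)%E] D by case.
  move: D VD; rewrite /events_of.
  rewrite -(setI_closed_g_dynkin_g_sigma_algebra (@cylinders_setI_closed V)).
  apply: smallest_sub; first exact: dynkin_independent.
  by move=> D VD; split; [exact: cylm|exact: VC].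
apply: (sigma_ind W) => //; first exact: events_of_measurable W'B.
move=> _ {WA} [s [C [us sW ->]]]; rewrite setIC muleC.
have mC : measurable (\bigcap_(u in [set` s]) (xi u @^-1` C u)).
  apply: (@events_of_measurable W); apply: sub_gen_smallest.
  by exists s, C.
apply: (sigma_ind W') => // _ [t [D [ut tW' ->]]].
have st u : u \in s -> u \in t -> False.
  by move=> /sW Wu /tW' W'u; have : (W `&` W') u by []; rewrite WW'.
(* Both families of constraints merge into one, since no label lies in both lists. *)
pose E u := if u \in s then C u else D u.
have := ind (t ++ s) E; rewrite big_cat /= cat_uniq us ut andbT /=.
have -> : ~~ has (mem t) s by apply/hasPn => u us'; apply/negP; exact: st.
move=> /(_ isT).
have -> : (\prod_(i <- t) P (xi i @^-1` E i))%E = P (\bigcap_(u in [set` t]) (xi u @^-1` D u)).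
  rewrite ind //; apply: eq_big_seq => u tu.
  by rewrite /E; case: ifPn => // su; case: (st u).
have -> : (\prod_(i <- s) P (xi i @^-1` E i))%E = P (\bigcap_(u in [set` s]) (xi u @^-1` C u)).
  by rewrite ind //; apply: eq_big_seq => u su; rewrite /E su.
move=> <-; congr (P _); apply/seteqP; split=> w /=.
  move=> [tw sw] u /=; rewrite mem_cat /E => /orP[tu|su].
    by case: ifPn => [su|_]; [case: (st u)|exact: tw].
  by rewrite su; exact: sw.
move=> h; split=> u /= tu.
  have := h u; rewrite /= mem_cat tu /E => /(_ isT).
  by case: ifPn => // su; case: (st u).
by have := h u; rewrite /= /E mem_cat tu orbT => /(_ isT).
Qed.

End Independence.

(** * Thinning of the fractional linear law *)

Section Series.
Context (R : realType).
Implicit Types (a c : nat -> R) (s p x : R).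

Lemma nneseries_geometric x p : 0 <= p < 1 ->
  (\sum_(0 <= k <oo) (x * p ^+ k)%:E)%E = (x / (1 - p))%:E.
Proof.
move=> /andP[p0 p1]; apply/cvg_lim => //.
under eq_fun do rewrite sumEFin.
apply: cvg_EFin; first by near=> n.
have -> : fine \o (fun n => (\sum_(0 <= k < n) x * p ^+ k)%:E) = series (geometric x p).
  by apply/funext.
by apply: cvg_geometric_series; rewrite ger0_norm.
Unshelve. all: by end_near. Qed.

Lemma nneseries_horner_recl a s : 0 <= s -> (forall k, 0 <= a k) ->
  (\sum_(0 <= k <oo) (a k * s ^+ k)%:E =
   (a 0%N)%:E + s%:E * \sum_(0 <= k <oo) (a k.+1 * s ^+ k)%:E)%E.
Proof.
move=> s0 a0; have as0 (k j : nat) : (0 <= (a k * s ^+ j)%:E)%E.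
  by rewrite lee_fin mulr_ge0 ?exprn_ge0.
rewrite nneseries_recl // expr0 mulr1 -nneseries_addn // -nneseriesZl //.
by congr (_ + _)%E; apply: eq_eseriesr => k _; rewrite addn1 -EFinM exprS mulrCA.
Qed.

(* The constant terms agree as s tends to 0; then divide by s. *)
Lemma nonneg_power_series_uniq a c (K : R) :
  (forall k, 0 <= a k) -> (forall k, 0 <= c k) ->
  (\sum_(0 <= k <oo) (a k)%:E <= K%:E)%E ->
  (\sum_(0 <= k <oo) (c k)%:E <= K%:E)%E ->
  (forall s, (0 < s <= 1)%R -> \sum_(0 <= k <oo) (a k * s ^+ k)%:E =
                           \sum_(0 <= k <oo) (c k * s ^+ k)%:E)%E ->
  a =1 c.
Proof.
(* Dropping the first coefficient keeps the bound [K], so the induction can shift the sequences. *)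
have tail f : (forall k, 0 <= f k) -> (\sum_(0 <= k <oo) (f k)%:E <= K%:E)%E ->
    (\sum_(0 <= k <oo) (f k.+1)%:E <= K%:E)%E.
  move=> f0; apply: le_trans; rewrite [leRHS]nneseries_recl //; last first.
    by move=> k _; rewrite lee_fin.
  rewrite -[X in (_ <= _ + X)%E]nneseries_addn; last by move=> k; rewrite lee_fin.
  under [X in (_ <= _ + X)%E]eq_eseriesr do rewrite addn1.
  by rewrite leeDr // lee_fin.
have head f g : (forall k, 0 <= f k) -> (forall k, 0 <= g k) ->
    (\sum_(0 <= k <oo) (g k)%:E <= K%:E)%E ->
    (forall s, (0 < s <= 1)%R -> \sum_(0 <= k <oo) (f k * s ^+ k)%:E =
                             \sum_(0 <= k <oo) (g k * s ^+ k)%:E)%E ->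
    f 0%N <= g 0%N.
  move=> f0 g0 gK fg.
  have K0 : 0 <= K.
    rewrite -lee_fin; apply: le_trans gK.
    by apply: nneseries_ge0 => k _ _; rewrite lee_fin.
  (* This [s] ensures [s * K <= e]; the minimum keeps it in the allowed range, and [K + 1] avoids a
     zero denominator. *)
  apply/ler_addgt0Pr => e e0; pose s := Num.min 1 (e / (K + 1)).
  have s0 : 0 < s by rewrite lt_min ltr01 divr_gt0 ?ltr_wpDl.
  have s1 : s <= 1 by rewrite ge_min lexx.
  have sK : s * K <= e.
    have -> : e = e / (K + 1) * (K + 1) by rewrite divfK ?gt_eqF ?ltr_wpDl.
    by apply: ler_pM; rewrite ?(ltW s0) // ?ge_min ?lexx ?orbT // lerDl.
  rewrite -lee_fin; have := fg s; rewrite s0 s1 => /(_ isT).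
  rewrite (nneseries_horner_recl (a := f)) ?(nneseries_horner_recl (a := g)) ?(ltW s0) // => E.
  apply: (@le_trans _ _ ((g 0%N)%:E + s%:E * K%:E)%E); last first.
    by rewrite -EFinM -EFinD lee_fin lerD2l.
  apply: (@le_trans _ _ ((f 0%N)%:E + s%:E * \sum_(0 <= k <oo) (f k.+1 * s ^+ k)%:E)%E).
    rewrite leeDl // mule_ge0 ?lee_fin ?(ltW s0) //.
    by apply: nneseries_ge0 => k _ _; rewrite lee_fin mulr_ge0 // exprn_ge0 // ltW.
  rewrite E leeD2l // lee_pmul2l // ?lte_fin //.
  apply: le_trans (tail _ g0 gK); apply: lee_nneseries => k _.
    by rewrite lee_fin mulr_ge0 // exprn_ge0 // ltW.
  by rewrite lee_fin ler_piMr // exprn_ile1 // ltW.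
move=> a0 c0 aK cK ac n.
elim: n a c a0 c0 aK cK ac => [|n IH] a c a0 c0 aK cK ac.
  apply/eqP; rewrite eq_le; apply/andP.
  by split; apply: head => // s /ac ->.
have ac0 : a 0%N = c 0%N.
  apply/eqP; rewrite eq_le; apply/andP.
  by split; apply: head => // s /ac ->.
apply: (IH (a \o S) (c \o S)) => //=; [exact: tail|exact: tail|].
move=> s s01; have /andP[s0 _] := s01; have := ac s s01.
rewrite (nneseries_horner_recl (a := a)) ?(nneseries_horner_recl (a := c))
  ?(ltW s0) // ac0 => /(congr1 (fun y => y - (c 0%N)%:E)%E).
rewrite ![((c 0%N)%:E + _)%E]addeC !addeK // => /(congr1 (fun y => s^-1%:E * y)%E).
by rewrite !muleA -EFinM mulVf ?gt_eqF // !mul1e.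
Qed.

(* The probability that at least m of k independent events of probability x
   occur, by conditioning on the last one. *)
Fixpoint binomial_tail (x : R) (k m : nat) : R :=
  match m, k with
  | 0, _ => 1
  | m'.+1, 0 => 0
  | m'.+1, k'.+1 =>
      (1 - x) * binomial_tail x k' m + x * binomial_tail x k' m'
  end.

Lemma binomial_tail_bounds x k m : 0 <= x <= 1 -> 0 <= binomial_tail x k m <= 1.
Proof.
move=> /andP[x0 x1]; elim: k m => [|k IH] [|m] /=; rewrite ?lexx ?ler01 //.
have /andP[? ?] := IH m.+1; have /andP[? ?] := IH m.
have x1' : 0 <= 1 - x by rewrite subr_ge0.
apply/andP; split; first by rewrite addr_ge0 // mulr_ge0.
have {2}-> : 1 = (1 - x) * 1 + x * 1 by rewrite !mulr1 subrK.
by rewrite lerD // ler_wpM2l.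
Qed.

(** The ratio of the geometric law of ratio [p] after thinning with probability [x]. *)
Definition offspring_ratio (p x : R) : R := p * x / (1 - p * (1 - x)).

(** The recursion of [binomial_tail] gives [U = p * ((1 - x) * U + x * U')] for the series [U] at
    [m + 1] and [U'] at [m]; solving it brings one factor [offspring_ratio p x]. *)
Lemma nneseries_binomial_tail p x m : 0 < p < 1 -> 0 <= x <= 1 ->
  (\sum_(0 <= k <oo) (binomial_tail x k m * p ^+ k)%:E)%E =
  (offspring_ratio p x ^+ m / (1 - p))%:E.
Proof.
move=> /andP[p0 p1] x01; have /andP[x0 x1] := x01.
have T0 k j : 0 <= binomial_tail x k j by have /andP[] := binomial_tail_bounds k j x01.
have Tp0 (k j : nat) i : (0 <= (binomial_tail x k j * p ^+ i)%:E)%E.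
  by rewrite lee_fin mulr_ge0 // exprn_ge0 // ltW.
elim: m => [|m IH].
  rewrite expr0 -nneseries_geometric ?(ltW p0) //.
  by apply: eq_eseriesr => -[].
set U := (\sum_(0 <= k <oo) _)%E.
have UE : U = (p%:E * ((1 - x)%:E * U + x%:E * (offspring_ratio p x ^+ m / (1 - p))%:E))%E.
  rewrite {1}/U nneseries_horner_recl ?(ltW p0) //= add0e -IH /U.
  congr (_ * _)%E; rewrite -!nneseriesZl // -nneseriesD; last 2 first.
  - by move=> k _ _; rewrite mule_ge0 // lee_fin subr_ge0.
  - by move=> k _ _; rewrite mule_ge0 // lee_fin.
  by apply: eq_eseriesr => k _; rewrite -!EFinM -EFinD mulrDl !mulrA.
(* The linear equation determines [U] only once [U] is finite; a geometric series bounds it. *)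
have : U \is a fin_num.
  rewrite ge0_fin_numE ?nneseries_ge0 //; apply: (@le_lt_trans _ _ (1 / (1 - p))%:E).
    rewrite -nneseries_geometric ?(ltW p0) //; apply: lee_nneseries => k _ //.
    rewrite lee_fin ler_wpM2r ?exprn_ge0 ?(ltW p0) //.
    by have /andP[] := binomial_tail_bounds k m.+1 x01.
  exact: ltry.
move: UE => /[swap] /fineK <-; rewrite -!EFinM => -[].
move: (fine U) => u uE; congr EFin.
have h1 : 1 - p != 0 by rewrite subr_eq0 gt_eqF.
have h2 : 1 - p * (1 - x) != 0.
  rewrite gt_eqF // subr_gt0; apply: le_lt_trans p1.
  by rewrite ler_piMr ?(ltW p0) // gerBl.
rewrite exprS /offspring_ratio; move: uE; set w := _ ^+ m => uE.
apply: (mulfI h2); transitivity (p * (x * (w / (1 - p)))); last first.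
  by field; rewrite h1 h2.
by rewrite mulrBl mul1r {1}uE; ring.
Qed.

Definition offspring_law (b p : R) (k : nat) : R :=
  if k is j.+1 then b * p ^+ j else 1 - b / (1 - p).

Lemma offspring_law_ge0 b p k : 0 < p < 1 -> 0 < b <= 1 - p ->
  0 <= offspring_law b p k.
Proof.
move=> /andP[p0 p1] /andP[b0 b1]; case: k => [|k] /=.
  by rewrite subr_ge0 ler_pdivrMr ?subr_gt0 // mul1r.
by rewrite mulr_ge0 ?exprn_ge0 // ltW.
Qed.

Lemma nneseries_offspring_law b p s : 0 < p < 1 -> 0 < b <= 1 - p ->
  0 <= s <= 1 ->
  (\sum_(0 <= k <oo) (offspring_law b p k * s ^+ k)%:E)%E =
  (fractional_linear b p s)%:E.
Proof.
move=> p01 b01 /andP[s0 s1]; have /andP[p0 p1] := p01.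
rewrite nneseries_horner_recl //; last by move=> k; exact: offspring_law_ge0.
rewrite (eq_eseriesr (g := fun k => (b * (p * s) ^+ k)%:E)); last first.
  by move=> k _; rewrite /= exprMn mulrA.
rewrite nneseries_geometric; last first.
  by rewrite mulr_ge0 ?(ltW p0) //= (le_lt_trans _ p1) // ler_piMr // ltW.
by rewrite -EFinM -EFinD /fractional_linear mulrA [s * b]mulrC.
Qed.

(** For [k >= 1] the law is [b / p * p ^+ k], and the term [k = 0] vanishes because the threshold is
    positive, so the modified mass at 0 drops out. *)
Lemma nneseries_offspring_tail b p x m : 0 < p < 1 -> 0 < b <= 1 - p ->
  0 <= x <= 1 ->
  (\sum_(0 <= k <oo) (offspring_law b p k * binomial_tail x k m.+1)%:E)%E =
  (b / (p * (1 - p)) * offspring_ratio p x ^+ m.+1)%:E.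
Proof.
move=> p01 b01 x01; have /andP[p0 p1] := p01; have /andP[b0 _] := b01.
have T0 k j : 0 <= binomial_tail x k j by have /andP[] := binomial_tail_bounds k j x01.
have qT0 k : (0 <= (offspring_law b p k * binomial_tail x k m.+1)%:E)%E.
  by rewrite lee_fin mulr_ge0 ?offspring_law_ge0.
rewrite nneseries_recl //= mulr0 add0e -nneseries_addn //.
have := nneseries_binomial_tail m.+1 p01 x01.
rewrite nneseries_horner_recl ?(ltW p0) //= add0e.
move=> /(congr1 (fun y => (b / p)%:E * y)%E).
rewrite muleA -EFinM divfK ?gt_eqF // -nneseriesZl => [E|k _]; last first.
  by rewrite lee_fin mulr_ge0 ?exprn_ge0 ?(ltW p0) // (T0 k.+1 m.+1).
transitivity ((b / p)%:E * (offspring_ratio p x ^+ m.+1 / (1 - p))%:E)%E.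
  rewrite -E; apply: eq_eseriesr => k _.
  by rewrite addn1 -EFinM mulrA mulrAC.
rewrite -EFinM; congr EFin; field.
by rewrite !gt_eqF // subr_gt0.
Qed.

End Series.

(** * Counting independent events among a random number of children *)

Section CountingEvents.
Context (d : measure_display) (Om : measurableType d) (R : realType)
        (P : probability Om R) (I : choiceType) (xi : I -> {RV P >-> nat})
        (ind : mutually_independent xi).
Context (W : nat -> set I) (E : nat -> set Om) (x : R).
Hypotheses (Wdisj : trivIset setT W) (WE : forall i, events_of xi (W i) (E i))
           (PE : forall i, P (E i) = x%:E).

Definition at_least (k m : nat) : set Om :=
  [set w | (m <= count (fun i => `[< E i w >]) (iota 0 k))%N].

Lemma at_least0 k : at_least k 0 = setT.
Proof. by apply/seteqP; split. Qed.

Lemma at_least0S m : at_least 0 m.+1 = set0.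
Proof. by apply/seteqP; split. Qed.

Lemma at_leastS k m :
  at_least k.+1 m.+1 = (at_least k m.+1 `&` ~` E k) `|` (at_least k m `&` E k).
Proof.
have SE w : at_least k.+1 m.+1 w =
    (m.+1 <= count (fun i => `[< E i w >]) (iota 0 k) + `[< E k w >])%N :> Prop.
  by rewrite /at_least /mkset -[k.+1]addn1 iotaD count_cat /= addn0 -addn1.
apply/seteqP; split=> w; rewrite SE /=.
  have [Ek|Ek] := pselect (E k w); first by rewrite (asboolT Ek) addn1; right.
  by rewrite (asboolF Ek) addn0; left.
move=> [[h nE]|[h Ek]]; first by rewrite (asboolF nE) addn0.
by rewrite (asboolT Ek) addn1.
Qed.

Lemma events_of_at_least V k m :
  (forall i, (i < k)%N -> events_of xi V (E i)) -> events_of xi V (at_least k m).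
Proof.
elim: k m => [|k IH] [|m] VE; rewrite ?at_least0 ?at_least0S.
- by rewrite -setC0; apply: events_ofC; exact: events_of0.
- exact: events_of0.
- by rewrite -setC0; apply: events_ofC; exact: events_of0.
have VE' i : (i < k)%N -> events_of xi V (E i) by move=> ik; apply: VE; exact: ltnW.
rewrite at_leastS; apply: events_ofU; apply: events_ofI; try exact: IH.
  by apply: events_ofC; exact: VE.
exact: VE.
Qed.

(** The first [k] events live on labels disjoint from [W k], so [E k] is independent of their count;
    splitting on [E k] reproduces the recursion of [binomial_tail]. *)
Lemma probability_at_least k m : P (at_least k m) = (binomial_tail x k m)%:E.
Proof.
elim: k m => [|k IH] [|m]; rewrite ?at_least0 ?at_least0S /= ?probability_setT ?measure0 //.
pose V := \bigcup_(i < k) W i.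
have Vev j : events_of xi V (at_least k j).
  apply: events_of_at_least => i ik; apply: (events_of_sub _ (@WE i)).
  by move=> u Wu; exists i.
have VW : V `&` W k = set0.
  rewrite /V setI_bigcupl; apply: bigcup0 => i /= ik.
  by move/trivIsetP: Wdisj; apply=> //; rewrite ltn_eqF.
have mW A : events_of xi (W k) A -> measurable A by exact: events_of_measurable.
have mV j : measurable (at_least k j) by exact: events_of_measurable (@Vev j).
rewrite at_leastS; transitivity (P (at_least k m.+1 `&` ~` E k) + P (at_least k m `&` E k))%E.
  apply: measureU.
  - by apply: measurableI => //; apply: measurableC; exact: mW.
  - by apply: measurableI => //; exact: mW.
  - by rewrite setIACA setICl setI0.
rewrite !(events_of_independent ind VW) //; last exact: events_ofC.
by rewrite !IH probability_setC ?PE; [rewrite -!EFinM -EFinD mulrC [x * _]mulrC|exact: mW].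
Qed.

Definition offspring_at_least (v : I) (m : nat) : set Om :=
  [set w | at_least (xi v w) m w].

Lemma offspring_at_leastE v m : offspring_at_least v m =
  \bigcup_k (xi v @^-1` [set k] `&` at_least k m).
Proof.
apply/seteqP; split=> w /=; first by move=> h; exists (xi v w).
by move=> [k _ [<-]].
Qed.

Lemma events_of_offspring_at_least V v m :
  V v -> (forall i, W i `<=` V) -> events_of xi V (offspring_at_least v m).
Proof.
move=> Vv WV; rewrite offspring_at_leastE; apply: events_of_bigcup => k.
apply: events_ofI; first exact: events_of_preimage.
by apply: events_of_at_least => i _; exact: (events_of_sub _ (@WE i)).
Qed.

(** Partition by the value of [xi v], which is independent of the counted events because [v] lies in
    no [W i]. *)
Lemma probability_offspring_at_least q v m :
  (forall i, ~ W i v) -> (forall k, P (xi v @^-1` [set k]) = (q k)%:E) ->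
  P (offspring_at_least v m) =
  (\sum_(0 <= k <oo) (q k * binomial_tail x k m)%:E)%E.
Proof.
move=> Wv Pq; pose V := \bigcup_i W i.
have Vev k : events_of xi V (at_least k m).
  by apply: events_of_at_least => i _; apply: (events_of_sub _ (@WE i)) => u; exists i.
have vev k : events_of xi [set v] (xi v @^-1` [set k]) by exact: events_of_preimage.
have mF k : measurable (xi v @^-1` [set k] `&` at_least k m).
  by apply: measurableI;
    [exact: events_of_measurable (@vev k)|exact: events_of_measurable (@Vev k)].
rewrite offspring_at_leastE measure_semi_bigcup //; last 2 first.
- apply/trivIsetP => i j _ _ ij; apply/seteqP; split=> // w /= [[Ei _] [Ej _]].
  by rewrite -Ei -Ej eqxx in ij.
- exact: bigcup_measurable.
apply: eq_eseriesr => k _.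
have vV : [set v] `&` V = set0.
  by apply/seteqP; split=> // u /= [-> [i _]]; exact: Wv.
apply: etrans (events_of_independent ind vV (@vev k) (@Vev k)) _.
by rewrite Pq probability_at_least EFinM.
Qed.

End CountingEvents.

(** * The largest fixed point *)

Section LargestFixedPoint.
Context (R : realType) (N : nat) (p b : R).
Hypotheses (N0 : (0 < N)%N) (p01 : 0 < p < 1) (b01 : 0 < b <= 1 - p).

(** For [t] in [0, 1], the chance of at least [N] good children when each child is good
    independently with probability [t]. *)
Definition survival_map (t : R) : R :=
  b / (p * (1 - p)) * offspring_ratio p t ^+ N.

Lemma offspring_ratio_den_gt0 t : 0 <= t -> 0 < 1 - p * (1 - t).
Proof.
move: p01 => /andP[p0 p1] t0.
by rewrite subr_gt0 (le_lt_trans _ p1) // ler_piMr ?(ltW p0) // gerBl.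
Qed.

Lemma offspring_ratio_ge0 t : 0 <= t -> 0 <= offspring_ratio p t.
Proof.
move: p01 => /andP[p0 p1] t0.
by rewrite divr_ge0 ?mulr_ge0 ?(ltW p0) // ltW // offspring_ratio_den_gt0.
Qed.

Lemma offspring_ratio_lt1 t : 0 <= t -> offspring_ratio p t < 1.
Proof.
move: p01 => /andP[p0 p1] t0.
rewrite ltr_pdivrMr ?offspring_ratio_den_gt0 // mul1r -subr_gt0.
by rewrite (_ : _ - _ = 1 - p) ?subr_gt0 //; ring.
Qed.

Lemma survival_map_const_ge0 : 0 <= b / (p * (1 - p)).
Proof.
move: p01 b01 => /andP[p0 p1] /andP[b0 _].
by rewrite divr_ge0 ?mulr_ge0 ?subr_ge0 // ltW.
Qed.

Lemma survival_map_le s t : 0 <= s -> s <= t -> survival_map s <= survival_map t.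
Proof.
move: p01 => /andP[p0 p1] s0 st; have t0 := le_trans s0 st.
apply: ler_wpM2l; first exact: survival_map_const_ge0.
apply: lerXn2r; rewrite ?nnegrE ?offspring_ratio_ge0 //.
rewrite ler_pdivrMr ?offspring_ratio_den_gt0 // mulrAC.
rewrite ler_pdivlMr ?offspring_ratio_den_gt0 // -subr_ge0.
rewrite (_ : _ - _ = p * (1 - p) * (t - s)); last by ring.
by rewrite !mulr_ge0 ?subr_ge0 // ltW.
Qed.

(** Both sides [m] and [y] of the equation for [tau] are nonnegative, so it may be raised to the
    power [N], and [survival_map t] is [t * (y ^+ N / m ^+ N)]. Positivity of [t] allows cancelling
    it: 0 is always fixed by [survival_map] but in general no solution. *)
Lemma tau_solutions_pos t : 0 < t <= 1 ->
  tau_solutions b p N t <-> survival_map t = t.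
Proof.
move: p01 b01 => /andP[p0 p1] /andP[b0 _] /andP[t0 t1].
have m0 : 0 < 1 - p * (1 - t) by apply: offspring_ratio_den_gt0; exact: ltW.
rewrite /tau_solutions /= (ltW t0) t1 /survival_map /offspring_ratio.
set m := 1 - p * (1 - t) in m0 *; set y := _ * _ `^ _.
have q0 : 0 < 1 - p by rewrite subr_gt0.
have y0 : 0 <= y by rewrite mulr_ge0 ?powR_ge0.
have Nn0 : N%:R != 0 :> R by rewrite pnatr_eq0 -lt0n.
have pt0 : 0 <= p * t by rewrite mulr_ge0 ?ltW.
have yN : y ^+ N = b / (1 - p) * (p * t) ^+ N.-1.
  rewrite /y exprMn -!powR_mulrn ?powR_ge0 // -!powRrM mulVf // powRr1; last first.
    by rewrite divr_ge0 ?ltW.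
  congr (_ * _ `^ _); rewrite mulrBl mul1r mulVf //.
  by rewrite -[in LHS](prednK N0) mulrSr addrK.
have E : b / (p * (1 - p)) * (p * t / m) ^+ N = t * (y ^+ N / m ^+ N).
  rewrite yN -[in LHS](prednK N0) exprSr exprMn exprVn -[in RHS](prednK N0) (exprSr m).
  by field; rewrite ?gt_eqF ?exprn_gt0.
rewrite E; split=> [[_ <-]|].
  by rewrite divff ?mulr1 // expf_neq0 // gt_eqF.
move=> /(canRL (mulKf _)); rewrite mulVf ?gt_eqF // => /(_ isT) h.
split=> //; apply/eqP; rewrite -(@eqrXn2 _ N) ?(ltW m0) //.
by rewrite -[eqbRHS](divfK (x := m ^+ N)) ?h ?mul1r // gt_eqF // exprn_gt0.
Qed.

Lemma tauE x : 0 <= x <= 1 -> survival_map x = x ->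
  (forall t, 0 < t <= 1 -> survival_map t = t -> t <= x) -> tau b p N = x.
Proof.
move=> /andP[x0 x1] xfix xmax.
have ub t : tau_solutions b p N t -> t <= x.
  move=> tsol; have [/andP[t0 t1] _] := tsol.
  move: t0; rewrite le_eqVlt => /orP[/eqP <- //|t0].
  have t01 : 0 < t <= 1 by rewrite t0.
  by apply: xmax => //; apply/tau_solutions_pos.
(* If [x = 0], either 0 is the only solution or there is none, and then the default value of [tau]
   is also 0. *)
move: (x0); rewrite le_eqVlt => /orP[/eqP x00|xgt0].
  rewrite /tau; case: xgetP => [t _ [tsol _]|//].
  apply/eqP; rewrite eq_le ub //=.
  by have [/andP[t0 _] _] := tsol; rewrite -x00.
apply: xget_unique.
  by split; [apply/tau_solutions_pos => //; rewrite xgt0|move=> t /ub].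
move=> t [tsol tub]; apply/eqP; rewrite eq_le ub //=; apply: tub.
by apply/tau_solutions_pos => //; rewrite xgt0.
Qed.

End LargestFixedPoint.

(** * The family tree *)

(** Contains [u] itself, whose own offspring number enters the events at [u]. *)
Definition descendants (u : node) : set node := [set v | prefix u v].

Lemma descendants_rcons_sub u i : descendants (rcons u i) `<=` descendants u.
Proof. by move=> v; apply: prefix_trans; exact: prefix_rcons. Qed.

Lemma descendants_rcons_notin u i : ~ descendants (rcons u i) u.
Proof. by move=> /size_prefix; rewrite size_rcons ltnn. Qed.

Lemma trivIset_descendants_rcons u :
  trivIset setT (fun i => descendants (rcons u i)).
Proof.
apply/trivIsetP => i j _ _ ij; apply/seteqP; split=> // v [].
rewrite /descendants /= !prefixE !size_rcons => /eqP -> /eqP /rcons_inj[E].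
by rewrite E eqxx in ij.
Qed.

Section TreeEvents.
Context (d : measure_display) (Om : measurableType d) (R : realType)
        (P : probability Om R) (N : nat) (p b : R) (xi : node -> {RV P >-> nat}).
Hypotheses (N0 : (0 < N)%N) (p01 : 0 < p < 1) (b01 : 0 < b <= 1 - p)
           (ind : mutually_independent xi)
           (law : forall u k, P (xi u @^-1` [set k]) = (offspring_law b p k)%:E).

Definition depth_event (n : nat) (u : node) : set Om :=
  [set w | nary_to_depth N (fun v => xi v w) n u].

Definition rooted_event (u : node) : set Om :=
  [set w | nary_rooted N (fun v => xi v w) u].

(** Distinct children carry disjoint label sets, none containing [u], so the offspring number of [u]
    is thinned independently. *)
Lemma probability_thinned_offspring (E : nat -> set Om) x u m : 0 <= x <= 1 ->
  (forall i, events_of xi (descendants (rcons u i)) (E i)) ->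
  (forall i, P (E i) = x%:E) ->
  P (offspring_at_least xi E u m.+1) =
  (b / (p * (1 - p)) * offspring_ratio p x ^+ m.+1)%:E.
Proof.
move=> x01 dE PE; rewrite -nneseries_offspring_tail //.
apply: (probability_offspring_at_least ind (@trivIset_descendants_rcons u)) => //.
by move=> i; exact: descendants_rcons_notin.
Qed.

Lemma depth_eventS n u : depth_event n.+1 u =
  offspring_at_least xi (fun i => depth_event n (rcons u i)) u N.
Proof.
apply/funext => w; congr (is_true (N <= _)%N); apply: eq_count => i.
exact/esym/asboolb.
Qed.

Lemma rooted_eventE u : rooted_event u =
  offspring_at_least xi (fun i => rooted_event (rcons u i)) u N.
Proof.
apply/funext => w; rewrite {1}/rooted_event /mkset nary_rootedE.
congr (is_true (N <= _)%N); apply: eq_count => i; exact/esym/asboolb.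
Qed.

Lemma events_of_depth_event n u : events_of xi (descendants u) (depth_event n u).
Proof.
elim: n u => [|n IH] u.
  rewrite (_ : depth_event 0 u = ~` set0); first by apply: events_ofC; exact: events_of0.
  by rewrite setC0; apply/seteqP; split.
rewrite depth_eventS.
apply: (events_of_offspring_at_least (W := fun i => descendants (rcons u i))) => //.
- exact: prefix_refl.
- by move=> i; exact: descendants_rcons_sub.
Qed.

Lemma rooted_event_bigcap u : rooted_event u = \bigcap_n depth_event n u.
Proof.
apply/seteqP; split=> w; first by move=> /asboolP gu n _; exact: gu.
by move=> gu; apply/asboolP => n; exact: gu.
Qed.

Lemma events_of_rooted_event u : events_of xi (descendants u) (rooted_event u).
Proof.
rewrite rooted_event_bigcap; apply: events_of_bigcap => n.
exact: events_of_depth_event.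
Qed.

Lemma measurable_rooted_event u : measurable (rooted_event u).
Proof. exact: events_of_measurable (@events_of_rooted_event u). Qed.

(** * The survival probability *)

Definition survival_iter (n : nat) : R := iter n (survival_map N p b) 1.

Lemma probability_depth_event n u :
  P (depth_event n u) = (survival_iter n)%:E /\ 0 <= survival_iter n <= 1.
Proof.
suff Pn : P (depth_event n u) = (survival_iter n)%:E.
  split=> //; rewrite -!lee_fin -Pn measure_ge0 probability_le1 //.
  exact: events_of_measurable (@events_of_depth_event n u).
elim: n u => [|n IH] u.
  rewrite (_ : depth_event 0 u = setT); first by rewrite probability_setT.
  by apply/seteqP; split.
have x01 : 0 <= survival_iter n <= 1.
  rewrite -!lee_fin -(IH u) measure_ge0 probability_le1 //.
  exact: events_of_measurable (@events_of_depth_event n u).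
rewrite depth_eventS -[N in LHS](prednK N0).
rewrite (probability_thinned_offspring _ x01) ?prednK //.
by move=> i; exact: events_of_depth_event.
Qed.

Lemma survival_iter_cvg u : (survival_iter n)%:E @[n --> \oo] --> P (rooted_event u).
Proof.
rewrite rooted_event_bigcap.
have -> : (fun n => (survival_iter n)%:E) = P \o (depth_event ^~ u).
  by apply/funext => n /=; rewrite (probability_depth_event n u).1.
apply: nonincreasing_cvg_mu.
- by rewrite ltey_eq fin_num_measure //; exact: events_of_measurable (@events_of_depth_event 0 u).
- by move=> n; exact: events_of_measurable (@events_of_depth_event n u).
- by rewrite -rooted_event_bigcap; exact: measurable_rooted_event.
- apply/nonincreasing_seqP => n; apply/subsetPset => w; exact: nary_to_depthS.
Qed.

(** The probability is a fixed point by [rooted_eventE], and the largest one because the iterates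
    from 1 stay above every fixed point of the monotone [survival_map] in (0, 1]. *)
Lemma probability_rooted_event u : P (rooted_event u) = (tau b p N)%:E.
Proof.
pose x := fine (P (rooted_event [::])).
(* For all labels the probability is the limit of the same sequence [survival_iter]. *)
have Px v : P (rooted_event v) = x%:E.
  rewrite /x fineK ?fin_num_measure //; last exact: measurable_rooted_event.
  exact: (cvg_unique _ (@survival_iter_cvg v) (@survival_iter_cvg [::])).
have x01 : 0 <= x <= 1.
  by rewrite -!lee_fin -(Px [::]) measure_ge0 probability_le1 //;
    exact: measurable_rooted_event.
rewrite Px; congr EFin; apply/esym/tauE => //.
  apply: EFin_inj; rewrite -(Px [::]) rooted_eventE -[N in RHS](prednK N0).
  rewrite (probability_thinned_offspring _ x01) ?prednK //.
  by move=> i; exact: events_of_rooted_event.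
move=> t /andP[t0 t1] tfix; rewrite -lee_fin -(Px [::]).
rewrite -(cvg_lim _ (@survival_iter_cvg [::])) //.
apply: lime_ge; first by apply/cvg_ex; exists (P (rooted_event [::])); exact: survival_iter_cvg.
apply: nearW => n; rewrite lee_fin; elim: n => [//|n IH] /=.
by rewrite -[leLHS]tfix survival_map_le // ltW.
Qed.

Lemma tau_ge0 : 0 <= tau b p N.
Proof. by rewrite -lee_fin -(probability_rooted_event [::]) measure_ge0. Qed.

Lemma tau_le1 : tau b p N <= 1.
Proof.
rewrite -lee_fin -(probability_rooted_event [::]) probability_le1 //.
exact: measurable_rooted_event.
Qed.

(** * Law and mean of the number of subtrees *)

Definition V_ge (j : nat) : set Om :=
  offspring_at_least xi (fun i => rooted_event [:: i]) [::] (j * N).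

Lemma measurable_V_ge j : measurable (V_ge j).
Proof.
apply: (events_of_measurable (W := setT)).
apply: (events_of_offspring_at_least (W := fun i => descendants [:: i])) => //.
by move=> i; exact: (events_of_rooted_event (u := [:: i])).
Qed.

Lemma probability_V_ge j :
  P (V_ge j.+1) = (b / (p * (1 - p)) * theta b p N ^+ j.+1)%:E.
Proof.
(* The thinning formula demands a positive threshold, here [j.+1 * N]; this exponent regroups into a
   power of [theta]. *)
rewrite /V_ge -(prednK (_ : 0 < j.+1 * N)%N) ?muln_gt0 //.
rewrite (probability_thinned_offspring (x := tau b p N)) ?tau_ge0 ?tau_le1 //.
- by rewrite prednK ?muln_gt0 // mulnC exprM.
- by move=> i; exact: (events_of_rooted_event (u := [:: i])).
- by move=> i; exact: probability_rooted_event.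
Qed.

Definition V_nat (w : Om) : nat :=
  count (fun i => nary_rooted N (fun v => xi v w) [:: i]) (iota 0 (xi [::] w)) %/ N.

Lemma V_geE j : V_ge j = [set w | (j <= V_nat w)%N].
Proof.
apply/funext => w; rewrite /V_nat /mkset leq_divRL //.
congr (is_true (j * N <= _)%N); apply: eq_count => i; exact: asboolb.
Qed.

Lemma VE w : V N xi w = (V_nat w)%:R%:E.
Proof. exact: max_disjoint_nary_subtreesE. Qed.

Lemma V_eq j : [set w | V N xi w = j%:R%:E] = V_ge j `\` V_ge j.+1.
Proof.
rewrite !V_geE; apply/seteqP; split=> w /=; rewrite VE.
  by move=> [/eqP]; rewrite eqr_nat => /eqP ->; rewrite leqnn ltnn.
move=> [jV /negP]; rewrite -leqNgt => Vj; congr (_%:R%:E).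
by apply/eqP; rewrite eqn_leq Vj.
Qed.

Lemma nneseries_indicator_lt n :
  (\sum_(0 <= j <oo) ((j < n)%N%:R : R)%:E)%E = (n%:R)%:E.
Proof.
rewrite (nneseries_split 0 n) //.
rewrite add0n eseries0; last by move=> i ni _; rewrite ltnNge ni.
rewrite adde0 sumEFin; congr EFin; rewrite big_mkord.
rewrite (eq_bigr (fun=> 1)) => [|i _]; last by rewrite ltn_ord.
by rewrite sumr_const card_ord.
Qed.

(** A natural number is the sum over [j >= 1] of the indicators that it is at least [j]; both
    measurability and the mean are read off from this. *)
Lemma V_series w : V N xi w = (\sum_(0 <= j <oo) (\1_(V_ge j.+1) w)%:E)%E.
Proof.
rewrite VE -nneseries_indicator_lt; apply: eq_eseriesr => j _.
rewrite indicE V_geE; congr (_%:R%:E); congr nat_of_bool.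
by apply/idP/idP => [jV|/set_mem //]; exact: mem_set.
Qed.

Lemma measurable_V : measurable_fun setT (V N xi).
Proof.
rewrite (_ : V N xi = fun w =>
  (\sum_(0 <= j <oo | j \in xpredT) (\1_(V_ge j.+1) w)%:E)%E); last first.
  by apply/funext => w; rewrite V_series.
apply: ge0_emeasurable_sum => [j w _ _|j _]; first by rewrite lee_fin.
by apply/measurable_EFinP; apply: measurable_indic; exact: measurable_V_ge.
Qed.

Lemma theta_ge0 : 0 <= theta b p N.
Proof. by rewrite exprn_ge0 //; apply: offspring_ratio_ge0 => //; exact: tau_ge0. Qed.

Lemma theta_lt1 : theta b p N < 1.
Proof.
by rewrite exprn_ilt1 -?lt0n //; [apply: offspring_ratio_ge0|apply: offspring_ratio_lt1];
  rewrite ?tau_ge0.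
Qed.

Lemma expectation_V : (\int[P]_w V N xi w)%E =
  (b / (p * (1 - p)) * (theta b p N / (1 - theta b p N)))%:E.
Proof.
under eq_integral do rewrite V_series.
rewrite integral_nneseries //; last first.
  by move=> j; apply/measurable_EFinP; apply: measurable_indic; exact: measurable_V_ge.
transitivity (\sum_(0 <= j <oo)
    (b / (p * (1 - p)) * theta b p N * theta b p N ^+ j)%:E)%E.
  apply: eq_eseriesr => j _; rewrite integral_indic ?setIT //; last exact: measurable_V_ge.
  by apply: etrans (probability_V_ge j) _; rewrite exprS mulrA.
by rewrite nneseries_geometric ?theta_ge0 ?theta_lt1 // mulrA.
Qed.

End TreeEvents.

(** * Identification of the offspring law and conclusion *)

Lemma offspring_law_unique (R : realType) (q : nat -> R) (b p : R) :
  0 < p < 1 -> 0 < b <= 1 - p -> (forall k, 0 <= q k) ->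
  (forall s, 0 <= s <= 1 -> pgf q s = (fractional_linear b p s)%:E) ->
  q =1 offspring_law b p.
Proof.
move=> p01 b01 q0 qpgf; have s1 : 0 <= (1 : R) <= 1 by rewrite ler01 lexx.
(* Both coefficient sums are bounded by the common value of the series at [s = 1]. *)
apply: (nonneg_power_series_uniq (K := fractional_linear b p 1)) => //.
- by move=> k; exact: offspring_law_ge0.
- rewrite -(qpgf 1 s1) /pgf; apply: lee_nneseries => k; first by rewrite lee_fin.
  by rewrite expr1n mulr1.
- rewrite -(nneseries_offspring_law p01 b01 s1); apply: lee_nneseries => k.
    by rewrite lee_fin offspring_law_ge0.
  by rewrite expr1n mulr1.
- move=> s /andP[s0 sle1]; have s01 : 0 <= s <= 1 by rewrite ltW.
  by rewrite nneseries_offspring_law // -qpgf.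
Qed.

Unset Implicit Arguments.

Theorem proposition1 (d : measure_display) (Om : measurableType d)
    (R : realType) (P : probability Om R)
    (N : nat) (p b : R) (q : nat -> R) (xi : node -> {RV P >-> nat})
    (hN : (1 <= N)%N) (hp : 0 < p < 1) (hb : 0 < b <= 1 - p)
    (hxi : BGW_process q xi)
    (hq : forall s : R, 0 <= s <= 1 ->
            pgf q s = (fractional_linear b p s)%:E) :
  [/\ measurable_fun [set: Om] (V N xi),
      (forall j : nat, (1 <= j)%N ->
         P [set w | V N xi w = j%:R%:E] =
         (b / (p * (1 - p)) * (1 - theta b p N) * theta b p N ^+ j)%:E),
      P [set w | V N xi w = 0%:E] =
        (1 - b / (p * (1 - p)) * theta b p N)%:E &
      (\int[P]_w V N xi w)%E =
        (b / (p * (1 - p)) * (theta b p N / (1 - theta b p N)))%:E].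
Proof.
have [ind lawq] := hxi.
(* The weights are nonnegative because they are probabilities. *)
have q0 k : 0 <= q k by rewrite -lee_fin -(lawq [::] k) measure_ge0.
have law u k : P (xi u @^-1` [set k]) = (offspring_law b p k)%:E.
  by rewrite lawq (offspring_law_unique hp hb q0 hq).
have mV j := measurable_V_ge N xi j.
have PV := probability_V_ge hN hp hb ind law.
split.
- exact: measurable_V.
- case=> [//|j] _; rewrite V_eq //.
  (* A point mass is the difference of two consecutive tail probabilities. *)
  transitivity (P (V_ge N xi j.+1) - P (V_ge N xi j.+2))%E; last first.
    by rewrite !PV -EFinB; congr EFin; move: (theta _ _ _) (b / _) => t C; rewrite !exprS; ring.
  have sub : V_ge N xi j.+2 `<=` V_ge N xi j.+1 by rewrite !V_geE // => w; exact: ltnW.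
  rewrite -[in RHS](setIidr sub); apply: measureD => //.
  by rewrite ltey_eq fin_num_measure.
- rewrite (_ : [set _ | _] = ~` V_ge N xi 1); last first.
    apply: etrans (V_eq xi hN 0) _; rewrite setDE (_ : V_ge N xi 0 = setT) ?setTI //.
    by rewrite V_geE //; apply/seteqP; split.
  by rewrite probability_setC // PV expr1.
- exact: expectation_V.
Qed.
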